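(* If a sequent is $\mathrm{LK}^{++}$-derivable, then it is already $\mathrm{LK}$-derivable.
   Context: Sequents. First-order formulae are built with $\bot,\wedge,\vee,\to,\forall,\exists$ ($\neg A$ is $A\to\bot$); free variables $a,b,c,\dots$ and bound variables $x,y,z,\dots$ are separate symbols; terms $t,s,\dots$ contain no bound variables (free variables are allowed). A sequent is $\Gamma\vdash\Delta$ with $\Gamma,\Delta$ finite lists of formulae. Derivations (also called proofs) are finite trees of sequents with axioms at the leaves and inferences at inner nodes; the root is the conclusion. $\mathrm{LK}$. Axioms: $\bot\vdash$ and $A\vdash A$ ($A$ atomic). Structural rules: weakening (from $\Gamma\vdash\Delta$ infer $\Gamma,A\vdash\Delta$ or $\Gamma\vdash\Delta,A$); contraction (from $\Gamma,A,A\vdash\Delta$ infer $\Gamma,A\vdash\Delta$; from $\Gamma\vdash\Delta,A,A$ infer $\Gamma\vdash\Delta,A$); exchange of adjacent formulae on either side; Cut (from $\Gamma\vdash\Delta,A$ and $A,\Gamma\vdash\Delta$ infer $\Gamma\vdash\Delta$). Logical rules: from $\Gamma,A\vdash\Delta$, or from $\Gamma,B\vdash\Delta$, infer $\Gamma,A\wedge B\vdash\Delta$; from $\Gamma\vdash\Delta,A$ and $\Gamma\vdash\Delta,B$ infer $\Gamma\vdash\Delta,A\wedge B$; from $\Gamma\vdash\Delta,A$, or from $\Gamma\vdash\Delta,B$, infer $\Gamma\vdash\Delta,A\vee B$; from $\Gamma,A\vdash\Delta$ and $\Gamma,B\vdash\Delta$ infer $\Gamma,A\vee B\vdash\Delta$;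 ($\to L$) from $\Gamma\vdash\Delta,A$ and $\Gamma,B\vdash\Delta$ infer $\Gamma,A\to B\vdash\Delta$; ($\to R$) from $\Gamma,A\vdash\Delta,B$ infer $\Gamma\vdash\Delta,A\to B$. Weak quantifier inferences: ($\forall L$) from $\Gamma,A(t)\vdash\Delta$ infer $\Gamma,\forall x\,A(x)\vdash\Delta$; ($\exists R$) from $\Gamma\vdash\Delta,A(t)$ infer $\Gamma\vdash\Delta,\exists x\,A(x)$. Strong quantifier inferences: ($\forall R$) from $\Gamma\vdash\Delta,A(a)$ infer $\Gamma\vdash\Delta,\forall x\,A(x)$; ($\exists L$) from $\Gamma,A(a)\vdash\Delta$ infer $\Gamma,\exists x\,A(x)\vdash\Delta$; here $a$ is a free variable, the characteristic variable of the inference, and the newly quantified formula is the critical formula. In $\mathrm{LK}$, the only restriction is that in $\forall R$ and $\exists L$ the variable $a$ does not appear in the conclusion of the inference. $\mathrm{LK}^{++}$. For a derivation $\pi$, write $a<_\pi b$ (''$b$ is a side variable of $a$'') if $\pi$ contains a strong quantifier inference with characteristic variable $a$ whose critical formula ($\forall x\,A(x,b,\vec c)$ on the right or $\exists x\,A(x,b,\vec c)$ on the left, inferred from $A(a,b,\vec c)$) contains the free variable $b$. A quantifier inference is weakly suitable for $\pi$ if it is a weak quantifier inference, or all of the following hold: (substitutability) its characteristic variable does not appear in the conclusion of $\pi$; (side-variable condition) the relation $<_\pi$ is acyclic; (very weak regularity) whenever its characteristic variable is also the characteristic variable of another strong quantifier inference in $\pi$, then that inference has the same critical formula. $\mathrm{LK}^{++}$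 is defined like $\mathrm{LK}$, except that the restriction on $\forall R,\exists L$ is dropped and instead all quantifier inferences are allowed with the proviso that they be weakly suitable for the whole proof $\pi$. *)

(* Defs.v *)
From Stdlib Require Import Relation_Operators.
From Stdlib Require List.
From mathcomp Require Import all_boot.

Set Implicit Arguments.
Unset Strict Implicit.
Unset Printing Implicit Defensive.

Record signature := Signature {
  fsym : Type;
  farity : fsym -> nat;
  psym : Type;
  parity : psym -> nat
}.

(** Free variables are named by natural numbers. Bound variables are a separate
    sort, represented by well-scoped de Bruijn indices: [semiterm S n] and
    [semiformula S n] may mention [n] bound variables whose quantifiers lie
    outside, so that formulae are identified up to the names of their bound
    variables. *)
Inductive semiterm (S : signature) (n : nat) : Type :=
| Free of nat
| Bound of 'I_n
| Fun (f : fsym S) of {ffun 'I_(farity f) -> semiterm S n}.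

Arguments Free {S n}.
Arguments Bound {S n}.
Arguments Fun {S n}.

Inductive semiformula (S : signature) (n : nat) : Type :=
| Bot
| Atom (p : psym S) of {ffun 'I_(parity p) -> semiterm S n}
| And of semiformula S n & semiformula S n
| Or of semiformula S n & semiformula S n
| Imp of semiformula S n & semiformula S n
| All of semiformula S n.+1
| Ex of semiformula S n.+1.

Arguments Bot {S n}.
Arguments Atom {S n}.
Arguments And {S n}.
Arguments Or {S n}.
Arguments Imp {S n}.
Arguments All {S n}.
Arguments Ex {S n}.

Notation term S := (semiterm S 0).
Notation formula S := (semiformula S 0).

Fixpoint tsubst S m n (s : 'I_m -> semiterm S n) (t : semiterm S m) :
    semiterm S n :=
  match t with
  | Free a => Free a
  | Bound i => s i
  | Fun f ts => Fun f [ffun i => tsubst s (ts i)]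
  end.

(* Passage of a substitution under a quantifier; index 0 is the innermost
   bound variable. *)
Definition up S m n (s : 'I_m -> semiterm S n) (i : 'I_m.+1) :
    semiterm S n.+1 :=
  if unlift ord0 i is Some j then tsubst (fun k => Bound (lift ord0 k)) (s j)
  else Bound ord0.

Fixpoint fsubst S m n (s : 'I_m -> semiterm S n) (A : semiformula S m) :
    semiformula S n :=
  match A with
  | Bot => Bot
  | Atom p ts => Atom p [ffun i => tsubst s (ts i)]
  | And B C => And (fsubst s B) (fsubst s C)
  | Or B C => Or (fsubst s B) (fsubst s C)
  | Imp B C => Imp (fsubst s B) (fsubst s C)
  | All B => All (fsubst (up s) B)
  | Ex B => Ex (fsubst (up s) B)
  end.

(* [inst A t] is A(t), where [A : semiformula S 1] is A(x). *)
Definition inst S (A : semiformula S 1) (t : term S) : formula S :=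
  fsubst (fun=> t) A.

Fixpoint tfv S n (t : semiterm S n) : seq nat :=
  match t with
  | Free a => [:: a]
  | Bound _ => [::]
  | Fun f ts => flatten [seq tfv (ts i) | i <- enum 'I_(farity f)]
  end.

Fixpoint fv S n (A : semiformula S n) : seq nat :=
  match A with
  | Bot => [::]
  | Atom p ts => flatten [seq tfv (ts i) | i <- enum 'I_(parity p)]
  | And B C | Or B C | Imp B C => fv B ++ fv C
  | All B | Ex B => fv B
  end.

Definition sequent_fv S (G D : seq (formula S)) : seq nat :=
  flatten [seq fv A | A <- G ++ D].

(** Trees built from the axioms and rules of LK, without any restriction on the
    characteristic variables [a] of [AllR] and [ExL]; LK and LK++ are the two
    ways of restricting them. In [AllR] and [ExL] the formula [A] may itself
    contain [a]. *)
Inductive derivation (S : signature) :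
    seq (formula S) -> seq (formula S) -> Type :=
| AxBot : derivation [:: Bot] [::]
| AxAtom p ts : derivation [:: Atom p ts] [:: Atom p ts]
| WeakL G D A : derivation G D -> derivation (rcons G A) D
| WeakR G D A : derivation G D -> derivation G (rcons D A)
| ContrL G D A :
    derivation (rcons (rcons G A) A) D -> derivation (rcons G A) D
| ContrR G D A :
    derivation G (rcons (rcons D A) A) -> derivation G (rcons D A)
| ExchL G1 G2 D A B :
    derivation (G1 ++ [:: A, B & G2]) D -> derivation (G1 ++ [:: B, A & G2]) D
| ExchR G D1 D2 A B :
    derivation G (D1 ++ [:: A, B & D2]) -> derivation G (D1 ++ [:: B, A & D2])
| Cut G D A :
    derivation G (rcons D A) -> derivation (A :: G) D -> derivation G D
| AndL1 G D A B : derivation (rcons G A) D -> derivation (rcons G (And A B)) D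
| AndL2 G D A B : derivation (rcons G B) D -> derivation (rcons G (And A B)) D
| AndR G D A B :
    derivation G (rcons D A) -> derivation G (rcons D B) ->
    derivation G (rcons D (And A B))
| OrR1 G D A B : derivation G (rcons D A) -> derivation G (rcons D (Or A B))
| OrR2 G D A B : derivation G (rcons D B) -> derivation G (rcons D (Or A B))
| OrL G D A B :
    derivation (rcons G A) D -> derivation (rcons G B) D ->
    derivation (rcons G (Or A B)) D
| ImpL G D A B :
    derivation G (rcons D A) -> derivation (rcons G B) D ->
    derivation (rcons G (Imp A B)) D
| ImpR G D A B :
    derivation (rcons G A) (rcons D B) -> derivation G (rcons D (Imp A B))
| AllL G D A t :
    derivation (rcons G (inst A t)) D -> derivation (rcons G (All A)) D
| ExR G D A t :
    derivation G (rcons D (inst A t)) -> derivation G (rcons D (Ex A))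
| AllR G D A a :
    derivation G (rcons D (inst A (Free a))) -> derivation G (rcons D (All A))
| ExL G D A a :
    derivation (rcons G (inst A (Free a))) D -> derivation (rcons G (Ex A)) D.

(** [Strong a C G D] is a strong quantifier inference with characteristic
    variable [a], critical formula [C] and conclusion [G |- D]. *)
Inductive quantifier_inference (S : signature) : Type :=
| Weak
| Strong (a : nat) (C : formula S) (G D : seq (formula S)).

Arguments Weak {S}.

Fixpoint quantifier_inferences S (G D : seq (formula S))
    (pi : derivation G D) : seq (quantifier_inference S) :=
  match pi with
  | AxBot | AxAtom _ _ => [::]
  | WeakL _ _ _ p | WeakR _ _ _ p | ContrL _ _ _ p | ContrR _ _ _ p
  | ExchL _ _ _ _ _ p | ExchR _ _ _ _ _ p
  | AndL1 _ _ _ _ p | AndL2 _ _ _ _ p | OrR1 _ _ _ _ p | OrR2 _ _ _ _ p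
  | ImpR _ _ _ _ p => quantifier_inferences p
  | Cut _ _ _ p q => quantifier_inferences p ++ quantifier_inferences q
  | AndR _ _ _ _ p q | OrL _ _ _ _ p q | ImpL _ _ _ _ p q =>
      quantifier_inferences p ++ quantifier_inferences q
  | AllL _ _ _ _ p | ExR _ _ _ _ p => Weak :: quantifier_inferences p
  | AllR G D A a p =>
      Strong a (All A) G (rcons D (All A)) :: quantifier_inferences p
  | ExL G D A a p =>
      Strong a (Ex A) (rcons G (Ex A)) D :: quantifier_inferences p
  end.

Definition LK S (G D : seq (formula S)) (pi : derivation G D) : Prop :=
  forall a C G' D', List.In (Strong a C G' D') (quantifier_inferences pi) ->
    a \notin sequent_fv G' D'.

(* [side_variable pi a b] is a <_pi b. The case b = a is included: it arises
   when the critical formula still contains its characteristic variable. *)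
Definition side_variable S (G D : seq (formula S)) (pi : derivation G D)
    (a b : nat) : Prop :=
  exists C G' D',
    List.In (Strong a C G' D') (quantifier_inferences pi) /\ b \in fv C.

Definition acyclic (r : nat -> nat -> Prop) : Prop :=
  forall a, ~ clos_trans nat r a a.

Definition weakly_suitable S (G D : seq (formula S)) (pi : derivation G D)
    (q : quantifier_inference S) : Prop :=
  match q with
  | Weak => True
  | Strong a C _ _ =>
      [/\ a \notin sequent_fv G D,
          acyclic (side_variable pi)
        & forall C' G' D',
            List.In (Strong a C' G' D') (quantifier_inferences pi) -> C' = C]
  end.

Definition LKpp S (G D : seq (formula S)) (pi : derivation G D) : Prop :=
  forall q, List.In q (quantifier_inferences pi) -> weakly_suitable pi q.

Definition LK_derivable S (G D : seq (formula S)) : Prop :=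
  exists pi : derivation G D, LK pi.

Definition LKpp_derivable S (G D : seq (formula S)) : Prop :=
  exists pi : derivation G D, LKpp pi.

(* Main.v *)
(** Given an LK++ proof of [G |- D], replace every strong inference with
    characteristic variable [a] and critical formula [All A] (resp. [Ex A]) by
    an application of [ImpL] to the Henkin formula [A(a) -> All A] (resp.
    [Ex A -> A(a)]), kept as an extra assumption. The result is an LK proof of
    [G] and all Henkin formulae [|- D]. The Henkin formulae are then discharged
    one at a time, each time choosing [a] minimal for the side-variable relation:
    such an [a] occurs neither in the conclusion nor in the remaining Henkin
    formulae, and not in its own critical formula, so it may serve as an
    eigenvariable. *)

Require Import Defs.
From Stdlib Require Import Relation_Operators Classical.
From Stdlib Require List.
From mathcomp Require Import all_boot.

Set Implicit Arguments.
Unset Strict Implicit.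
Unset Printing Implicit Defensive.

(** * List membership and minimal elements of acyclic relations *)

Lemma In_cat T (x : T) s1 s2 :
  List.In x (s1 ++ s2) <-> List.In x s1 \/ List.In x s2.
Proof. exact: List.in_app_iff. Qed.

Lemma In_rcons T (x y : T) s : List.In x (rcons s y) <-> List.In x s \/ y = x.
Proof. by rewrite -cats1 In_cat /=; tauto. Qed.

Ltac solve_incl :=
  let X := fresh in
  move=> X; rewrite ?(In_rcons, In_cat) /= ?(In_rcons, In_cat) /=; intuition.

Lemma acyclic_sub (R R' : nat -> nat -> Prop) :
  (forall a b, R a b -> R' a b) -> acyclic R' -> acyclic R.
Proof.
move=> sRR' acR'.
have sRR'_trans a b : clos_trans nat R a b -> clos_trans nat R' a b.
  elim=> [c d /sRR'|c d e _ R'cd _]; first exact: t_step.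
  exact: t_trans R'cd.
by move=> a /sRR'_trans; apply: acR'.
Qed.

Lemma exists_minimal (R : nat -> nat -> Prop) (s : seq nat) :
  acyclic R -> s <> [::] ->
  exists2 a, a \in s & forall c, c \in s -> ~ R c a.
Proof.
move=> acR s_neq0.
(* Minimality for the transitive closure is the stronger claim, and it lets the induction replace
   the old minimum by a new head lying below it. *)
suff [a sa mina]: exists2 a, a \in s & forall c, c \in s -> ~ clos_trans nat R c a.
  by exists a => // c sc /(t_step _ _ _ _); apply: mina.
elim: s s_neq0 => [//|x [|y s] IHs] _.
  by exists x; rewrite ?mem_head // => c; rewrite inE => /eqP ->; apply: acR.
have [//|a sa mina] := IHs.
have [Rxa | nRxa] := classic (clos_trans nat R x a).
  exists x => [|c]; first exact: mem_head.
  rewrite inE => /predU1P[-> | sc]; first exact: acR.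
  by move=> Rcx; apply: (mina c sc); apply: t_trans Rcx Rxa.
exists a => [|c]; first by rewrite inE sa orbT.
by rewrite inE => /predU1P[-> // | ]; apply: mina.
Qed.

(** * Free variables and formula size under substitution *)

Section FreeVariables.

Variable S : signature.

(** Recursion on the term itself makes the hypothesis available for the arguments nested inside the
    finite function. *)
Fixpoint tfv_tsubst m n (s : 'I_m -> semiterm S n) b (t : semiterm S m)
    {struct t} :
  (forall i, b \notin tfv (s i)) -> b \notin tfv t -> b \notin tfv (tsubst s t).
Proof.
case: t => [a|i|f ts] //= sb tsb.
apply/negP => /flatten_mapP[i _]; rewrite ffunE; apply/negP.
apply: tfv_tsubst => //; apply: contra tsb => tsib.
by apply/flatten_mapP; exists i => //; rewrite mem_enum.
Qed.

Lemma tfv_up m n (s : 'I_m -> semiterm S n) b i :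
  (forall i, b \notin tfv (s i)) -> b \notin tfv (up s i).
Proof. by rewrite /up => sb; case: unliftP => [j|] _ //; apply: tfv_tsubst. Qed.

Lemma fv_fsubst m n (s : 'I_m -> semiterm S n) b (A : semiformula S m) :
  (forall i, b \notin tfv (s i)) -> b \notin fv A -> b \notin fv (fsubst s A).
Proof.
elim: A n s => {m} [//|m p ts|m A IHA B IHB|m A IHA B IHB|m A IHA B IHB
  |m A IHA|m A IHA] n s sb /=.
- move=> tsb; apply/negP => /flatten_mapP[i _]; rewrite ffunE; apply/negP.
  apply: tfv_tsubst => //; apply: contra tsb => tsib.
  by apply/flatten_mapP; exists i => //; rewrite mem_enum.
- by rewrite !mem_cat !negb_or => /andP[/IHA-> // /IHB->].
- by rewrite !mem_cat !negb_or => /andP[/IHA-> // /IHB->].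
- by rewrite !mem_cat !negb_or => /andP[/IHA-> // /IHB->].
- by apply: IHA => i; apply: tfv_up.
- by apply: IHA => i; apply: tfv_up.
Qed.

Lemma fv_inst (A : semiformula S 1) a b :
  b != a -> b \notin fv A -> b \notin fv (inst A (Free a)).
Proof. by move=> ba Ab; apply: fv_fsubst => // _; rewrite inE. Qed.

Lemma sequent_fvP (G D : seq (formula S)) a :
  a \notin sequent_fv G D <->
  forall A, List.In A G \/ List.In A D -> a \notin fv A.
Proof.
rewrite /sequent_fv; setoid_rewrite <- In_cat.
elim: (G ++ D) => [|B s IHs] /=; first by split.
rewrite mem_cat negb_or; split=> [/andP[aB /IHs as_] A [<- // | ] | as_].
  exact: as_.
by apply/andP; split; [| apply/IHs => A sA]; apply: as_; auto.
Qed.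

Lemma exists_fresh (A : formula S) : exists a, a \notin fv A.
Proof.
exists (\max_(b <- fv A) b).+1; apply/negP => Aa.
by have := @leq_bigmax_seq _ _ xpredT id _ Aa isT; rewrite ltnn.
Qed.

(** Measure for the induction in [LK_id]: atoms weigh 0 whatever their terms, so [inst A t] is
    smaller than [All A] and [Ex A] without being a structural subterm. *)
Fixpoint fsize n (A : semiformula S n) : nat :=
  match A with
  | Bot | Atom _ _ => 0
  | And B C | Or B C | Imp B C => (fsize B + fsize C).+1
  | All B | Ex B => (fsize B).+1
  end.

Lemma fsize_fsubst m n (s : 'I_m -> semiterm S n) (A : semiformula S m) :
  fsize (fsubst s A) = fsize A.
Proof.
by elim: A n s => {m} //= [m A IHA B IHB|m A IHA B IHB|m A IHA B IHB
  |m A IHA|m A IHA] n s; rewrite ?IHA ?IHB.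
Qed.

End FreeVariables.

(** * Rules of LK up to the order and multiplicity of side formulae *)

Section Rules.

Variable S : signature.
Implicit Types (G D : seq (formula S)) (A B C : formula S).

(** The eigenvariable condition of LK concerns each strong inference separately, so joining two
    proofs by a two-premise rule preserves it. *)
Lemma LK_cat G1 D1 G2 D2 (p : derivation G1 D1) (q : derivation G2 D2) :
  LK p -> LK q -> forall a C G' D',
  List.In (Strong a C G' D') (quantifier_inferences p ++ quantifier_inferences q) ->
  a \notin sequent_fv G' D'.
Proof.
by move=> LKp LKq a C G' D' /In_cat[]; [apply: LKp | apply: LKq].
Qed.

Lemma LK_weakL G D A : LK_derivable G D -> LK_derivable (rcons G A) D.
Proof. by case=> p LKp; exists (WeakL A p). Qed.

Lemma LK_weakR G D A : LK_derivable G D -> LK_derivable G (rcons D A).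
Proof. by case=> p LKp; exists (WeakR A p). Qed.

Lemma LK_moveL G1 G2 D A :
  LK_derivable (G1 ++ A :: G2) D <-> LK_derivable (G1 ++ rcons G2 A) D.
Proof.
elim: G2 G1 => [|B G2 IH] G1 //=.
rewrite -(cat_rcons B) -IH cat_rcons.
by split; case=> p LKp; [exists (ExchL p) | exists (ExchL p)].
Qed.

Lemma LK_moveR G D1 D2 A :
  LK_derivable G (D1 ++ A :: D2) <-> LK_derivable G (D1 ++ rcons D2 A).
Proof.
elim: D2 D1 => [|B D2 IH] D1 //=.
rewrite -(cat_rcons B) -IH cat_rcons.
by split; case=> p LKp; [exists (ExchR p) | exists (ExchR p)].
Qed.

(** Both copies of [A] are moved to the end by exchanges, contracted there, and the remaining one is
    moved back. *)
Lemma LK_contrL G D A : List.In A G -> LK_derivable (A :: G) D -> LK_derivable G D.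
Proof.
move=> /(@List.in_split _ _ _)[G1 [G2 ->]].
move/(LK_moveL [::]); rewrite /= -[(G1 ++ _)%list]/(G1 ++ A :: G2) rcons_cat /=.
rewrite -rcons_cons => /LK_moveL; rewrite -!rcons_cat => -[p LKp].
apply/LK_moveL; rewrite -rcons_cat.
by exists (ContrL p).
Qed.

Lemma LK_contrR G D A : List.In A D -> LK_derivable G (A :: D) -> LK_derivable G D.
Proof.
move=> /(@List.in_split _ _ _)[D1 [D2 ->]].
move/(LK_moveR _ [::]); rewrite /= -[(D1 ++ _)%list]/(D1 ++ A :: D2) rcons_cat /=.
rewrite -rcons_cons => /LK_moveR; rewrite -!rcons_cat => -[p LKp].
apply/LK_moveR; rewrite -rcons_cat.
by exists (ContrR p).
Qed.

(** Weaken by all of [G'] and [D'], then contract away the formulae of [G] and [D] one by one. *)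
Lemma LK_incl G D G' D' :
  List.incl G G' -> List.incl D D' -> LK_derivable G D -> LK_derivable G' D'.
Proof.
move=> sG sD GD.
have: LK_derivable (G ++ G') D.
  by elim/last_ind: G' {sG} => [|G' A IH]; rewrite ?cats0 // -rcons_cat; apply: LK_weakL.
have {GD}: LK_derivable G' D -> LK_derivable G' (D ++ D').
  move=> GD'; elim/last_ind: D' {sD} => [|D' A IH]; rewrite ?cats0 // -rcons_cat.
  exact: LK_weakR.
move=> weakD contrG.
have {weakD contrG}: LK_derivable G' (D ++ D').
  apply: weakD; elim: G sG contrG => [//|A G IH] sG GD.
  apply: IH => [B GB|]; first by apply: sG; right.
  by apply: LK_contrL GD; rewrite In_cat; right; apply: sG; left.
elim: D sD => [//|A D IH] sD GD.
apply: IH => [B DB|]; first by apply: sD; right.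
by apply: LK_contrR GD; rewrite In_cat; right; apply: sD; left.
Qed.

Lemma LK_cut G D A :
  LK_derivable G (A :: D) -> LK_derivable (A :: G) D -> LK_derivable G D.
Proof.
move=> /(LK_moveR _ [::])[p LKp] [q LKq].
by exists (Cut p q); apply: LK_cat.
Qed.

Lemma LK_impR G D A B :
  LK_derivable (A :: G) (B :: D) -> LK_derivable G (Imp A B :: D).
Proof.
move/(LK_moveL [::])/(LK_moveR _ [::]) => -[p LKp]; apply/(LK_moveR _ [::]).
by exists (ImpR p).
Qed.

(** Contraction keeps the principal formula in the context, so a Henkin assumption can be used
    repeatedly. *)
Lemma LK_impL G D A B : List.In (Imp A B) G ->
  LK_derivable G (A :: D) -> LK_derivable (B :: G) D -> LK_derivable G D.
Proof.
move=> GAB /(LK_moveR _ [::])[p LKp] /(LK_moveL [::])[q LKq].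
apply: LK_contrL GAB _; apply/(LK_moveL [::]).
by exists (ImpL p q); apply: LK_cat.
Qed.

(** The actual inference concludes a permutation of this sequent, and freshness depends only on
    membership. *)
Lemma LK_allR G D (A : semiformula S 1) a : a \notin sequent_fv G (All A :: D) ->
  LK_derivable G (inst A (Free a) :: D) -> LK_derivable G (All A :: D).
Proof.
move=> /sequent_fvP fresh /(LK_moveR _ [::])[p LKp]; apply/(LK_moveR _ [::]).
exists (AllR p) => b C G' D' /= [[<- _ <- <-] | ]; last exact: LKp.
by apply/sequent_fvP => B; rewrite In_rcons => GDB; apply: fresh => /=; tauto.
Qed.

Lemma LK_exL G D (A : semiformula S 1) a : a \notin sequent_fv (Ex A :: G) D ->
  LK_derivable (inst A (Free a) :: G) D -> LK_derivable (Ex A :: G) D.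
Proof.
move=> /sequent_fvP fresh /(LK_moveL [::])[p LKp]; apply/(LK_moveL [::]).
exists (ExL p) => b C G' D' /= [[<- _ <- <-] | ]; last exact: LKp.
by apply/sequent_fvP => B; rewrite In_rcons => GDB; apply: fresh => /=; tauto.
Qed.

(** Axioms cover only atoms and [Bot] on the left. Compound formulae are decomposed on both sides;
    under a quantifier, a fresh eigenvariable also serves as the term of the weak inference. *)
Lemma LK_id A : LK_derivable [:: A] [:: A].
Proof.
have [n] := ubnP (fsize A); elim: n A => // n IHn A.
have fresh1 B a : a \notin fv B -> a \notin sequent_fv [:: B] [:: B].
  by move=> aB; apply/sequent_fvP => _ /= [[<-|[]]|[<-|[]]].
have LK_idI G D B : fsize B < n -> List.In B G -> List.In B D -> LK_derivable G D.
  by move=> /IHn idB GB DB; apply: LK_incl idB => _ [<-|[]].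
case: A => [|p ts|A B|A B|A B|A|A] /=; rewrite ltnS => ltAn.
- have bot: LK_derivable [:: @Bot S 0] [::] by exists (AxBot S).
  exact: LK_weakR bot.
- by exists (AxAtom ts).
- have [p LKp]: LK_derivable [:: And A B] [:: A].
    have [|p LKp] := IHn A; first by apply: leq_ltn_trans ltAn; apply: leq_addr.
    by exists (@AndL1 _ [::] _ A B p).
  have [q LKq]: LK_derivable [:: And A B] [:: B].
    have [|q LKq] := IHn B; first by apply: leq_ltn_trans ltAn; apply: leq_addl.
    by exists (@AndL2 _ [::] _ A B q).
  by exists (@AndR _ _ [::] A B p q); apply: LK_cat.
- have [p LKp]: LK_derivable [:: A] [:: Or A B].
    have [|p LKp] := IHn A; first by apply: leq_ltn_trans ltAn; apply: leq_addr.
    by exists (@OrR1 _ _ [::] A B p).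
  have [q LKq]: LK_derivable [:: B] [:: Or A B].
    have [|q LKq] := IHn B; first by apply: leq_ltn_trans ltAn; apply: leq_addl.
    by exists (@OrR2 _ _ [::] A B q).
  by exists (@OrL _ [::] _ A B p q); apply: LK_cat.
- apply: LK_impR; apply: (@LK_impL _ _ A B); first by right; left.
    apply: (LK_idI _ _ A) => /=; auto.
    by apply: leq_ltn_trans ltAn; apply: leq_addr.
  apply: (LK_idI _ _ B) => /=; auto.
  by apply: leq_ltn_trans ltAn; apply: leq_addl.
- have [a aA] := exists_fresh (All A).
  apply: (@LK_allR _ _ _ a); first exact: fresh1.
  have [|p LKp] := IHn (inst A (Free a)); first by rewrite fsize_fsubst.
  by exists (@AllL _ [::] _ A (Free a) p) => b C G' D' /= [//|]; apply: LKp.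
- have [a aA] := exists_fresh (Ex A).
  apply: (@LK_exL _ _ _ a); first exact: fresh1.
  have [|p LKp] := IHn (inst A (Free a)); first by rewrite fsize_fsubst.
  by exists (@ExR _ _ [::] A (Free a) p) => b C G' D' /= [//|]; apply: LKp.
Qed.

Lemma LK_ax G D A : List.In A G -> List.In A D -> LK_derivable G D.
Proof. by move=> GA DA; apply: LK_incl (LK_id A) => _ [<-|[]]. Qed.

End Rules.

(** * Henkin formulae *)

Section Henkin.

Variable S : signature.
Implicit Types (G D H : seq (formula S)) (C : formula S).

(* Only quantified [C] are relevant; the default value is an arbitrary
   derivable formula. *)
Definition henkin a C : formula S :=
  match C with
  | All A => Imp (inst A (Free a)) (All A)
  | Ex A => Imp (Ex A) (inst A (Free a))
  | C => Imp C C
  end.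

(** Instantiating the matrix of [C] adds no free variable except [a]. *)
Lemma fv_henkin a b C : b != a -> b \notin fv C -> b \notin fv (henkin a C).
Proof.
move=> ba bC; have: b \notin fv (Imp C C) by rewrite /= mem_cat negb_or bC.
case: C bC => // A bA _; rewrite /= mem_cat negb_or; apply/andP; split=> //;
  exact: fv_inst.
Qed.

(** Every strong inference disappears, so no condition on [pi] is needed. Keeping [H] in front
    leaves the principal formulae at the end of the antecedent. *)
Lemma LK_of_derivation H G D (pi : derivation G D) :
  (forall a C G' D', List.In (Strong a C G' D') (quantifier_inferences pi) ->
     List.In (henkin a C) H) ->
  LK_derivable (H ++ G) D.
Proof.
elim: pi => {G D} [|p ts|G D A p IH|G D A p IH|G D A p IH|G D A p IH
  |G1 G2 D A B p IH|G D1 D2 A B p IH|G D A p IHp q IHq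
  |G D A B p IH|G D A B p IH|G D A B p IHp q IHq
  |G D A B p IH|G D A B p IH|G D A B p IHp q IHq
  |G D A B p IHp q IHq|G D A B p IH|G D A t p IH|G D A t p IH
  |G D A a p IH|G D A a p IH] /= hH.
all: try (have {}IH := IH hH).
(* With two premises, the Henkin formulae of each are among those of the whole proof. *)
all: try (have {}IHp := IHp (fun a C G' D' pC =>
            hH a C G' D' (proj2 (In_cat _ _ _) (or_introl pC)));
          have {}IHq := IHq (fun a C G' D' qC =>
            hH a C G' D' (proj2 (In_cat _ _ _) (or_intror qC)))).
- have bot: LK_derivable [:: @Bot S 0] [::] by exists (AxBot S).
  by apply: LK_incl bot; solve_incl.
- by apply: (LK_ax (A := Atom p ts)); rewrite ?In_cat /=; auto.
- by apply: LK_incl IH; solve_incl.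
- by apply: LK_incl IH; solve_incl.
- by apply: LK_incl IH; solve_incl.
- by apply: LK_incl IH; solve_incl.
- by apply: LK_incl IH; solve_incl.
- by apply: LK_incl IH; solve_incl.
- apply: (LK_cut (A := A)); first by apply: LK_incl IHp; solve_incl.
  by apply: LK_incl IHq; solve_incl.
- by move: IH; rewrite -!rcons_cat => -[r LKr]; exists (AndL1 B r).
- by move: IH; rewrite -!rcons_cat => -[r LKr]; exists (AndL2 A r).
- by case: IHp IHq => [r LKr] [s LKs]; exists (AndR r s); apply: LK_cat.
- by case: IH => r LKr; exists (OrR1 B r).
- by case: IH => r LKr; exists (OrR2 A r).
- move: IHp IHq; rewrite -!rcons_cat => -[r LKr] [s LKs].
  by exists (OrL r s); apply: LK_cat.
- move: IHp IHq; rewrite -!rcons_cat => -[r LKr] [s LKs].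
  by exists (ImpL r s); apply: LK_cat.
- by move: IH; rewrite -!rcons_cat => -[r LKr]; exists (ImpR r).
- have {}IH := IH (fun a C G' D' pC => hH a C G' D' (or_intror pC)).
  move: IH; rewrite -!rcons_cat => -[r LKr].
  by exists (AllL r) => b C G' D' /= [//|]; apply: LKr.
- have [r LKr] := IH (fun a C G' D' pC => hH a C G' D' (or_intror pC)).
  by exists (ExR r) => b C G' D' /= [//|]; apply: LKr.
- have {}IH := IH (fun a C G' D' pC => hH a C G' D' (or_intror pC)).
  (* The translated premise gives the left branch; the right one is an identity on [All A]. The
     existential case below swaps these roles. *)
  apply: (@LK_impL _ _ _ (inst A (Free a)) (All A)).
  + by rewrite In_cat; left; apply: (hH a (All A)); left.
  + by apply: LK_incl IH; solve_incl.
  + by apply: (LK_ax (A := All A)); rewrite ?In_rcons /=; auto.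
- have {}IH := IH (fun a C G' D' pC => hH a C G' D' (or_intror pC)).
  apply: (@LK_impL _ _ _ (Ex A) (inst A (Free a))).
  + by rewrite In_cat; left; apply: (hH a (Ex A)); left.
  + by apply: (LK_ax (A := Ex A)); rewrite ?In_cat ?In_rcons /=; auto.
  + by apply: LK_incl IH; solve_incl.
Qed.

(** Cut with the implication, which is classically derivable both from [B] and with [A] as an
    alternative in the succedent. *)
Lemma LK_imp_inv G D (A B : formula S) : LK_derivable (Imp A B :: G) D ->
  LK_derivable G (A :: D) /\ LK_derivable (B :: G) D.
Proof.
move=> HGD; split; apply: (LK_cut (A := Imp A B)).
- by apply: LK_impR; apply: (LK_ax (A := A)) => /=; auto.
- by apply: LK_incl HGD; solve_incl.
- by apply: LK_impR; apply: (LK_ax (A := B)) => /=; auto.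
- by apply: LK_incl HGD; solve_incl.
Qed.

(** Inversion yields a branch containing the instance at [a] and a branch containing [C]. Freshness
    permits a strong inference in the former, and a cut on [C] joins them. *)
Lemma LK_henkin_elim G D a C : a \notin fv C -> a \notin sequent_fv G D ->
  LK_derivable (henkin a C :: G) D -> LK_derivable G D.
Proof.
move=> aC /sequent_fvP aGD.
(* This covers the default value of [henkin] for unquantified [C]. *)
have trivial: LK_derivable (Imp C C :: G) D -> LK_derivable G D.
  move=> CGD; apply: (LK_cut (A := Imp C C)) => //.
  by apply: LK_impR; apply: (LK_ax (A := C)) => /=; auto.
case: C aC trivial => [|p ts|A B|A B|A B|A|A] aC trivial //= /LK_imp_inv[GA BG].
  apply: LK_cut BG; apply: LK_allR GA.
  by apply/sequent_fvP => B [GB | [<- // | DB]]; apply: aGD; auto.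
apply: (LK_cut GA); apply: LK_exL BG.
by apply/sequent_fvP => B [[<- // | GB] | DB]; apply: aGD; auto.
Qed.

(** Induction on the length of [L], discharging a variable that occurs in no critical formula of
    [L], its own included. *)
Lemma LK_henkins_elim G D (L : seq (nat * formula S)) :
  (forall a C C', List.In (a, C) L -> List.In (a, C') L -> C' = C) ->
  (forall a C, List.In (a, C) L -> a \notin sequent_fv G D) ->
  acyclic (fun a b => exists2 C, List.In (a, C) L & b \in fv C) ->
  LK_derivable ([seq henkin x.1 x.2 | x <- L] ++ G) D -> LK_derivable G D.
Proof.
have [n] := ubnP (size L); elim: n L => // n IHn L ltLn funL freshL acL LGD.
have [L0 | L_neq0] := classic (L = [::]); first by rewrite L0 in LGD.
have domP (a : nat) : a \in [seq x.1 | x <- L] <-> exists C, List.In (a, C) L.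
  elim: (L) => [|[b B] s IHs] /=; first by split=> // -[].
  rewrite inE; split=> [/predU1P[->|/IHs[C sC]]|[C [[-> _]|sC]]].
  - by exists B; left.
  - by exists C; right.
  - by rewrite eqxx.
  - by apply/orP; right; apply/IHs; exists C.
have [|a /domP[C LaC] mina] := exists_minimal (s := [seq x.1 | x <- L]) acL.
  by case: (L) L_neq0.
have fresh_a b B : List.In (b, B) L -> a \notin fv B.
  move=> LbB; apply/negP => aB.
  by apply: (mina b); [apply/domP; exists B | exists B].
(* Several inferences may share the variable [a]; all their pairs are removed at once, since by
   [funL] they carry the same formula [C]. *)
pose L' := [seq x <- L | x.1 != a].
have L'P x : List.In x L' <-> List.In x L /\ x.1 != a by apply: List.filter_In.
apply: (IHn L').
(* The list shrinks strictly because the pair of [a] and [C] is filtered out. *)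
- rewrite -ltnS; apply: leq_trans ltLn; rewrite ltnS size_filter.
  rewrite -(count_predC (fun x => x.1 != a) L) -addn1 leq_add2l.
  rewrite -has_count; elim: (L) LaC => [//|x s IHs] /= [->|/IHs->].
    by rewrite /= eqxx.
  by rewrite orbT.
- by move=> b B B' /L'P[LbB _] /L'P[LbB' _]; apply: funL LbB LbB'.
- by move=> b B /L'P[LbB _]; apply: freshL LbB.
- by apply: acyclic_sub acL => b c [B /L'P[LbB _] cB]; exists B.
apply: (@LK_henkin_elim _ _ a C); first exact: fresh_a LaC.
  apply/sequent_fvP => B; have /sequent_fvP aGD := freshL _ _ LaC.
  rewrite In_cat => -[[|GB]|DB]; [|by apply: aGD; auto..].
  move=> /(@List.in_map_iff _ _ _ _ _)[[b E] [<- /L'P[LbE /= ba]]].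
  by apply: fv_henkin; [rewrite eq_sym | apply: fresh_a LbE].
apply: LK_incl LGD => // B; rewrite /= !In_cat => -[|]; last by auto.
move=> /(@List.in_map_iff _ _ _ _ _)[[b E] [<- LbE]] /=.
have [eq_ba | ba] := eqVneq b a.
  by left; rewrite eq_ba in LbE *; rewrite (funL _ _ _ LaC LbE).
right; left; apply/(@List.in_map_iff _ _ _ _ _); exists (b, E); split=> //.
exact/L'P.
Qed.

End Henkin.

(** * Critical formulae of an LK++ proof and the final assembly *)

Definition critical S (qs : seq (quantifier_inference S)) : seq (nat * formula S) :=
  pmap (fun q => if q is Strong a C _ _ then Some (a, C) else None) qs.

Lemma In_critical S (qs : seq (quantifier_inference S)) a C :
  List.In (a, C) (critical qs) <->
  exists G' D', List.In (Strong a C G' D') qs.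
Proof.
elim: qs => [|[|b B G1 D1] qs IHqs]; first by split=> // -[? []].
  rewrite /= IHqs; split=> -[G' [D' qsC]]; exists G', D'; first by right.
  by case: qsC.
split=> /= [[[-> ->]|/IHqs[G' [D' qsC]]]|[G' [D' [[-> -> _ _]|qsC]]]].
- by exists G1, D1; left.
- by exists G', D'; right.
- by left.
- by right; apply/IHqs; exists G', D'.
Qed.

Theorem theorem2p8 (S : signature) (G D : seq (formula S)) :
  LKpp_derivable G D -> LK_derivable G D.
Proof.
case=> pi suitable; set qs := quantifier_inferences pi.
(* The first three premises come from very weak regularity, substitutability and the side-variable
   condition, in this order. *)
apply: (@LK_henkins_elim _ _ _ (critical qs)).
- move=> a C C' /In_critical[G1 [D1 piC]] /In_critical[G2 [D2 piC']].
  by have [_ _ /(_ _ _ _ piC')] := suitable _ piC.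
- by move=> a C /In_critical[G1 [D1 piC]]; have [] := suitable _ piC.
(* Acyclicity is granted only through some strong inference, so a critical formula for the start of
   the chain is carried along to supply one. *)
- have sub a b : clos_trans nat
      (fun a b => exists2 C, List.In (a, C) (critical qs) & b \in fv C) a b ->
    clos_trans nat (side_variable pi) a b /\ exists C, List.In (a, C) (critical qs).
    elim=> [x y [C xC yC]|x y z _ [xy xC] _ [yz _]]; last first.
      by split=> //; apply: t_trans xy yz.
    split; last by exists C.
    have [G1 [D1 piC]] := proj1 (In_critical _ _ _) xC.
    by apply: t_step; exists C, G1, D1.
  move=> a /sub[aa [C /In_critical[G1 [D1 piC]]]].
  by have [_ ac _] := suitable _ piC; apply: ac aa.
- apply: (@LK_of_derivation _ _ _ _ pi) => a C G' D' piC.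
  apply/(@List.in_map_iff _ _ _ _ _); exists (a, C); split=> //.
  by apply/In_critical; exists G', D'.
Qed.
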